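(* Let $w\in\{\mathtt a,\mathtt b\}^n$ with $|w|_{\mathtt a}>0$. Then the cardinality of the $\sim_{3/2}$-class of $w$ in $\{\mathtt a,\mathtt b\}^n$ is $$\#[w]_{\sim_{3/2}}=\sum_{i=0}^{|w|_{\mathtt a}-1}[q^{\,|w|_{\mathtt a}\operatorname{strip}(w)+i}]\binom{n}{|w|_{\mathtt a}}_{\!q}.$$
   Context: $|w|_{\mathtt a}$ is the number of letters $\mathtt a$ in $w$ and $\binom{w}{\mathtt{ab}}$ the number of occurrences of $\mathtt{ab}$ as a scattered subword of $w$. Set $\operatorname{strip}(w)=\lfloor\binom{w}{\mathtt{ab}}/|w|_{\mathtt a}\rfloor$ if $|w|_{\mathtt a}>0$, and $0$ if $|w|_{\mathtt a}=0$. For $u,w\in\{\mathtt a,\mathtt b\}^n$, $u\sim_{3/2}w$ iff $|u|_{\mathtt a}=|w|_{\mathtt a}$ and $\operatorname{strip}(u)=\operatorname{strip}(w)$. The Gaussian binomial coefficient is the polynomial $\binom{c}{d}_q=\prod_{i=1}^d\frac{1-q^{c-d+i}}{1-q^i}$ for $0\le d\le c$; $[q^k]f$ is the coefficient of $q^k$ in $f$. *)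

(* Defs.v *)
From mathcomp Require Import all_boot all_order all_algebra.
From mathcomp Require Import ring.

Set Implicit Arguments.
Unset Strict Implicit.
Unset Printing Implicit Defensive.

Import GRing.Theory.

Notation letter := bool (only parsing).
Notation la := true (only parsing).
Notation lb := false (only parsing).

(* An occurrence of [v] as a scattered subword of [w] is a choice of positions
   of [w], i.e. a bit mask of length [size w], at which [w] reads [v]. *)
Definition subword_count (T : eqType) (w v : seq T) : nat :=
  #|[set m : (size w).-tuple bool | mask m w == v]|.

Definition strip (w : seq letter) : nat :=
  if 0 < count_mem la w
  then subword_count w [:: la; lb] %/ count_mem la w
  else 0.

Definition sim32 (n : nat) : rel (n.-tuple letter) :=
  fun u w => (count_mem la u == count_mem la w) && (strip u == strip w).

Local Open Scope ring_scope.

(* Meant for [d <= c]. The quotient is exact: see [gaussian_binomialE]. *)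
Definition gaussian_binomial (c d : nat) : {poly int} :=
  (\prod_(1 <= i < d.+1) (1 - 'X^(c - d + i)))
    %/ \prod_(1 <= i < d.+1) (1 - 'X^i).

Lemma prod_1subXn_dvd (m d : nat) : exists g : {poly int},
  g * \prod_(1 <= i < d.+1) (1 - 'X^i) = \prod_(1 <= i < d.+1) (1 - 'X^(m + i)).
Proof.
elim: d m => [|d IHd] m; first by exists 1; rewrite !big_nil mulr1.
elim: m => [|m [g Hg]]; first by exists 1; rewrite mul1r.
have [h Hh] := IHd m.+1.
exists (g + 'X^(m.+1) * h).
have Es : \prod_(1 <= i < d.+2) (1 - 'X^(m + i)) =
    (1 - 'X^(m.+1)) * \prod_(1 <= i < d.+1) (1 - 'X^(m.+1 + i)) :> {poly int}.
  rewrite big_nat_recl // addn1; congr (_ * _).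
  by apply: eq_bigr => i _; rewrite addnS addSn.
have Er (F : nat -> {poly int}) :
  \prod_(1 <= i < d.+2) F i = (\prod_(1 <= i < d.+1) F i) * F d.+1.
  by rewrite big_nat_recr.
rewrite mulrDl Hg Es !Er -Hh exprD; ring.
Qed.

Lemma lead_coef_1subXn (i : nat) :
  (0 < i)%N -> lead_coef (1 - 'X^i : {poly int}) = -1.
Proof.
by move=> i0; rewrite -opprB lead_coefN lead_coefXnsubC.
Qed.

Lemma gaussian_binomialM (c d : nat) :
  gaussian_binomial c d * \prod_(1 <= i < d.+1) (1 - 'X^i) =
  \prod_(1 <= i < d.+1) (1 - 'X^(c - d + i)).
Proof.
have [g Hg] := prod_1subXn_dvd (c - d) d.
rewrite /gaussian_binomial -Hg Pdiv.IdomainUnit.mulpK //.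
rewrite lead_coef_prod big_nat.
apply: (big_ind (fun x : int => x \is a GRing.unit)) => //.
  by move=> x y Hx Hy; rewrite unitrM Hx.
by move=> i /andP[i0 _]; rewrite lead_coef_1subXn.
Qed.

Local Notation tofrac := (@FracField.tofrac {poly int}).

Lemma gaussian_binomialE (c d : nat) :
  tofrac (gaussian_binomial c d) =
  \prod_(1 <= i < d.+1) (tofrac (1 - 'X^(c - d + i)) / tofrac (1 - 'X^i))
  :> {fraction {poly int}}.
Proof.
rewrite big_split prodfV -!rmorph_prod -gaussian_binomialM rmorphM /= mulfK //.
rewrite tofrac_eq0 prodf_seq_neq0; apply/allP => i.
rewrite mem_index_iota => /andP[i0 _] /=; apply/negP => /eqP E.
by have := lead_coef_1subXn i0; rewrite E lead_coef0.
Qed.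

(* Main.v *)
Require Import Defs.
From mathcomp Require Import all_boot all_order all_algebra.
From mathcomp Require Import ring.

Set Implicit Arguments.
Unset Strict Implicit.
Unset Printing Implicit Defensive.

(** The Gaussian binomial is the generating polynomial of the statistic
    [binom(u, ab)] over the words [u] of length [c] with [d] letters [a]: by
    removing the first letter, both satisfy
    [B(c+1, d+1) = q^(c-d) B(c, d) + B(c, d+1)].  When [|u|_a = k], the
    condition [strip u = s] says that [binom(u, ab)] is one of
    [k s, ..., k s + k - 1], so the class is counted by the sum of the
    coefficients with these indices. *)

Import GRing.Theory.

Local Open Scope ring_scope.

Lemma big_tupleS (R : Type) (idx : R) (op : Monoid.com_law idx) (T : finType)
    (n : nat) (F : seq T -> R) :
  \big[op/idx]_(t : n.+1.-tuple T) F t =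
  \big[op/idx]_(x : T) \big[op/idx]_(t : n.-tuple T) F (x :: t).
Proof.
rewrite pair_big /=.
rewrite (reindex (fun p : T * n.-tuple T => [tuple of p.1 :: p.2])) //=.
exists (fun t : n.+1.-tuple T => (thead t, [tuple of behead t])).
  by case=> x t _; congr (_, _); apply: val_inj.
by move=> t _; rewrite -tuple_eta.
Qed.

Lemma big_tuple0 (R : Type) (idx : R) (op : Monoid.com_law idx) (T : finType)
    (F : seq T -> R) :
  \big[op/idx]_(t : 0.-tuple T) F t = F [::].
Proof. by rewrite (big_pred1 [tuple]) // => t; rewrite [t]tuple0 /= eqxx. Qed.

Lemma subword_countE (T : eqType) (w v : seq T) :
  subword_count w v = (\sum_(m : (size w).-tuple bool) (mask m w == v))%N.
Proof. by rewrite /subword_count cardsE -sum1_card big_mkcond. Qed.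

Lemma subword_count_nil (T : eqType) (v : seq T) :
  subword_count [::] v = (v == [::]).
Proof.
rewrite subword_countE /=.
by rewrite (big_tuple0 _ (fun m => nat_of_bool (mask m [::] == v))) eq_sym.
Qed.

(** The two terms correspond to the first bit of the mask: either the occurrence uses [x] or it lies
    in [w]. *)
Lemma subword_count_cons (T : eqType) (x : T) (w v : seq T) :
  subword_count (x :: w) v =
  (\sum_(m : (size w).-tuple bool) (x :: mask m w == v)
   + subword_count w v)%N.
Proof.
rewrite !subword_countE /=.
rewrite (big_tupleS _ _ (fun m => nat_of_bool (mask m (x :: w) == v))).
by rewrite big_bool.
Qed.

Lemma subword_count0 (T : eqType) (w : seq T) : subword_count w [::] = 1%N.
Proof.
elim: w => [|x w IHw]; first by rewrite subword_count_nil.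
by rewrite subword_count_cons IHw big1.
Qed.

Lemma subword_count_cons_cons (T : eqType) (x y : T) (w v : seq T) :
  subword_count (x :: w) (y :: v) =
  ((x == y) * subword_count w v + subword_count w (y :: v))%N.
Proof.
rewrite subword_count_cons [subword_count w v]subword_countE; congr addn.
by rewrite big_distrr /=; apply: eq_bigr => m _; rewrite eqseq_cons mulnb.
Qed.

Lemma subword_count1 (T : eqType) (x : T) (w : seq T) :
  subword_count w [:: x] = count_mem x w.
Proof.
elim: w => [|y w IHw]; first by rewrite subword_count_nil.
by rewrite subword_count_cons_cons subword_count0 IHw muln1.
Qed.

(** The condition on the number of letters [la] is a multiplicity and not a filter, so that
    [big_tupleS] and [big_tuple0] apply. *)
Definition ab_poly (n k : nat) : {poly int} :=
  \sum_(u : n.-tuple letter)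
    'X^(subword_count u [:: la; lb]) *+ (count_mem la u == k).

Lemma ab_poly0 (k : nat) : ab_poly 0 k = (k == 0%N)%:R.
Proof.
rewrite /ab_poly (big_tuple0 _ (fun u =>
  'X^(subword_count u [:: la; lb]) *+ (count_mem la u == k))).
by rewrite subword_count_nil expr0 /= eq_sym.
Qed.

Lemma ab_polyS0 (n : nat) : ab_poly n.+1 0 = ab_poly n 0.
Proof.
rewrite /ab_poly (big_tupleS _ _ (fun u =>
  'X^(subword_count u [:: la; lb]) *+ (count_mem la u == 0%N))).
rewrite big_bool /= big1 ?add0r //.
by apply: eq_bigr => u _; rewrite subword_count_cons_cons.
Qed.

(** A first letter [la] pairs with each of the [n - k] letters [lb] after it; a first letter [lb]
    starts no occurrence. For [n < k] the truncated exponent is harmless, as [ab_poly n k] is then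
    zero. *)
Lemma ab_polyS (n k : nat) :
  ab_poly n.+1 k.+1 = 'X^(n - k) * ab_poly n k + ab_poly n k.+1.
Proof.
rewrite /ab_poly (big_tupleS _ _ (fun u =>
  'X^(subword_count u [:: la; lb]) *+ (count_mem la u == k.+1))).
rewrite big_bool /= mulr_sumr; congr (_ + _); last first.
  by apply: eq_bigr => u _; rewrite subword_count_cons_cons.
apply: eq_bigr => u _.
rewrite subword_count_cons_cons subword_count1 eqxx mul1n add1n eqSS exprD.
have [<-|_] := eqVneq; last by rewrite !mulr0n mulr0.
rewrite !mulr1n; congr ('X^ _ * _).
rewrite -[X in (X - _)%N](size_tuple u) -(count_predC (pred1 la)) addKn.
by apply: eq_count => -[].
Qed.

Lemma ab_poly_small (n k : nat) : (n < k)%N -> ab_poly n k = 0.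
Proof.
move=> nk; rewrite /ab_poly big1 // => u _.
suff /negPf -> : count_mem la u != k by [].
by rewrite neq_ltn (leq_ltn_trans (count_size _ _)) // size_tuple.
Qed.

(** Induction on [d], then on [m]. After the common factors are taken out, the recurrence amounts to
    $q^{m+1}(1-q^{d+1}) + (1-q^{m+1}) = 1-q^{m+d+2}$. *)
Lemma ab_polyM (m d : nat) :
  ab_poly (m + d) d * \prod_(1 <= i < d.+1) (1 - 'X^i) =
  \prod_(1 <= i < d.+1) (1 - 'X^(m + i)).
Proof.
elim: d m => [|d IHd] m.
  rewrite !big_nil mulr1 addn0.
  by elim: m => [|m IHm]; rewrite ?ab_poly0 // ab_polyS0.
have Er (F : nat -> {poly int}) :
  \prod_(1 <= i < d.+2) F i = (\prod_(1 <= i < d.+1) F i) * F d.+1.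
  by rewrite big_nat_recr.
elim: m => [|m IHm].
  (* No word of length [d] has [d.+1] letters [la], so only the first term of the recurrence
     survives. *)
  rewrite ab_polyS subnn expr0 mul1r (ab_poly_small (ltnSn d)) addr0.
  by rewrite !Er mulrA (IHd 0%N).
(* Splitting off the factor at [i = 1] leaves the product that [IHd] gives at [m.+1]. *)
have Es : \prod_(1 <= i < d.+2) (1 - 'X^(m + i)) =
    (1 - 'X^(m.+1)) * \prod_(1 <= i < d.+1) (1 - 'X^(m.+1 + i)) :> {poly int}.
  rewrite big_nat_recl // addn1; congr (_ * _).
  by apply: eq_bigr => i _; rewrite addnS addSn.
rewrite addnS ab_polyS addnK mulrDl addSnnS IHm Es !Er -addSnnS -IHd exprD.
ring.
Qed.

Lemma gaussian_binomial_ab_poly (n k : nat) :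
  (k <= n)%N -> gaussian_binomial n k = ab_poly n k.
Proof.
move=> kn; have Pn0 : \prod_(1 <= i < k.+1) (1 - 'X^i) != 0 :> {poly int}.
  rewrite prodf_seq_neq0; apply/allP => i.
  rewrite mem_index_iota => /andP[i0 _]; apply/eqP => E.
  by have := lead_coef_1subXn i0; rewrite E lead_coef0.
by apply: (mulIf Pn0); rewrite gaussian_binomialM -ab_polyM subnK.
Qed.

(** By uniqueness of Euclidean division, only [i = x %% k] can contribute, and it does so exactly
    when the quotient is [s]. *)
Lemma eq_divn_sum (k s x : nat) : (0 < k)%N ->
  (x %/ k == s)%N%:R = \sum_(0 <= i < k) (k * s + i == x)%N%:R :> int.
Proof.
move=> k0; rewrite big_mkord; have [<-|xs] := eqVneq.
  rewrite (bigD1 (Ordinal (ltn_pmod x k0))) //= mulnC -divn_eq eqxx.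
  rewrite big1 ?addr0 // => i /eqP ik; case: eqP => // E; case: ik.
  by apply: val_inj; rewrite /= -E modnMDl modn_small.
rewrite big1 // => i _; case: eqP => // E.
by move: xs; rewrite -E mulnC divnMDl // divn_small // addn0 eqxx.
Qed.

Theorem proposition10 (n : nat) (w : n.-tuple letter)
    (hw : (0 < count_mem la w)%N) :
  #|[set u : n.-tuple letter | sim32 u w]|%:Z =
  \sum_(0 <= i < count_mem la w)
    (gaussian_binomial n (count_mem la w))`_(count_mem la w * strip w + i)%N.
Proof.
have kn : (count_mem la w <= n)%N by rewrite -{2}(size_tuple w) count_size.
rewrite gaussian_binomial_ab_poly //; under eq_bigr do rewrite coef_sum.
(* With both sides written as sums over all words [u], the claim can be checked word by word. *)
rewrite exchange_big /= cardsE -sum1_card big_mkcond /= -natz natr_sum.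
apply: eq_bigr => u _; under eq_bigr do rewrite coefMn coefXn.
rewrite sumrMnl unfold_in /sim32; case: eqP => [E|_] /=; last by rewrite mulr0n.
rewrite mulr1n -eq_divn_sum // /strip E hw.
by case: eqP.
Qed.
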